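(* Let $C_\phi$ be a composition operator on a directed graph with one circuit (as defined in the context) and suppose $C_\phi\in\boldsymbol B(L^2(\mu))$. Then $C_\phi$ is completely hyperexpansive if and only if it is $2$-isometric.
   Context: Setting. $\mathbb N=\{1,2,\ldots\}$. Let $\kappa\in\mathbb N$, $\eta\in\mathbb N\cup\{\infty\}$, $J_{[1,\eta]}=\{i\in\mathbb N: i\le\eta\}$ (so $J_{[1,\infty]}=\mathbb N$), and let $X=\{x_1,\ldots,x_\kappa\}\cup\{x_{i,j}: i\in J_{[1,\eta]},\, j\in\mathbb N\}$, all the listed points being distinct. Let $\mathscr A$ be the $\sigma$-algebra of all subsets of $X$ and $\mu$ a positive measure on $\mathscr A$ with $\mu(x):=\mu(\{x\})\in(0,\infty)$ for all $x\in X$. Define $\phi\colon X\to X$ by $\phi(x_{i,j})=x_{i,j-1}$ for $j\ge2$, $\phi(x_{i,1})=x_\kappa$, $\phi(x_1)=x_\kappa$, and $\phi(x_i)=x_{i-1}$ for $2\le i\le\kappa$. The operator $C_\phi f=f\circ\phi$ in the complex space $L^2(\mu)=L^2(X,\mathscr A,\mu)$ is called a composition operator on a directed graph with one circuit. $C_\phi\in\boldsymbol B(L^2(\mu))$ means that $C_\phi$ is everywhere defined and bounded on $L^2(\mu)$. For a bounded operator $T$ on a Hilbert space put $\mathscr B_m(T)=\sum_{k=0}^m(-1)^k\binom mk T^{*k}T^k$. $T$ is $2$-isometric if $\mathscr B_2(T)=0$, and completely hyperexpansive if $\mathscr B_n(T)\le0$ for every $n\in\mathbb N$. *)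

(* Defs.v *)
From HB Require Import structures.
From mathcomp Require Import all_boot all_order all_algebra.
From mathcomp Require Import sesquilinear complex.
From mathcomp Require Import ring.
From mathcomp Require Import all_classical all_reals all_analysis.

Set Implicit Arguments.
Unset Strict Implicit.
Unset Printing Implicit Defensive.
Import Order.TTheory GRing.Theory Num.Theory.
Import numFieldNormedType.Exports.
Local Open Scope classical_set_scope.
Local Open Scope ring_scope.

Definition inner_product (C : numClosedFieldType) (V : lmodType C) :=
  {dot V for @Num.conj C}.

Section operators.
Context (C : numClosedFieldType) (V : lmodType C) (dot : inner_product V).
Implicit Type T : V -> V.

Definition bounded_operator T :=
  linear T /\
  exists M : C, forall f, sqrtC (dot (T f) (T f)) <= M * sqrtC (dot f f).

(* [adjoint T g] is the h with <T f, g> = <f, h> for all f; such an h is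
   unique ([adjointE]), and exists when T is bounded and V is complete. *)
Definition adjoint T : V -> V :=
  fun g => xget 0 [set h | forall f, dot (T f) g = dot f h].

Definition defect (m : nat) T : V -> V :=
  fun f => \sum_(k < m.+1)
    ((-1) ^+ k * 'C(m, k)%:R) *: iter k (adjoint T) (iter k T f).

(* The order on C makes [z <= 0] say that z is real and nonpositive. *)
Definition nonpositive_operator T := forall f, dot (T f) f <= 0.

Definition two_isometric T := forall f, defect 2 T f = 0.

Definition completely_hyperexpansive T :=
  forall n, (0 < n)%N -> nonpositive_operator (defect n T).

Lemma adjointE T g h : (forall f, dot (T f) g = dot f h) -> adjoint T g = h.
Proof.
move=> Th; pose A := [set h | forall f, dot (T f) g = dot f h].
have Th' : A (adjoint T g) by apply: (@xgetPex _ 0 A); exists h.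
apply/eqP; rewrite -subr_eq0 -(dnorm_eq0 dot) linearBr /=.
by rewrite -Th -Th' subrr.
Qed.

End operators.

(* J_[1,eta], shifted to start at 0; [None] stands for eta = oo. *)
Definition in_branch (eta : option nat) : pred nat :=
  fun i => if eta is Some n then (i < n)%N else true.

Definition branch (eta : option nat) := {i : nat | in_branch eta i}.

(* The set X for kappa = k.+1, with all indices starting at 0: [inl i] is
   x_{i+1} and [inr (i, j)] is x_{i+1,j+1}. *)
Definition vertex (k : nat) (eta : option nat) : Type :=
  ('I_k.+1 + branch eta * nat)%type.

(* [ord_max] is x_kappa; [ord_pred] sends 0 to [ord_max] and i.+1 to i. *)
Definition phi k eta (x : vertex k eta) : vertex k eta :=
  match x with
  | inr (i, j.+1) => inr (i, j)
  | inr (i, 0%N) => inl ord_max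
  | inl i => inl (ord_pred i)
  end.

Section vertex_measurable.
Context (k : nat) (eta : option nat).

HB.instance Definition _ :=
  Choice.copy (vertex k eta) ('I_k.+1 + branch eta * nat)%type.
HB.instance Definition _ := isPointed.Build (vertex k eta) (inl ord0).
HB.instance Definition _ := @isMeasurable.Build default_measure_display
  (vertex k eta) discrete_measurable discrete_measurable0
  discrete_measurableC discrete_measurableU.

End vertex_measurable.

Definition normsq (R : realType) (z : R[i]) : R :=
  complex.Re z ^+ 2 + complex.Im z ^+ 2.

Section L2.
Context (R : realType) (k : nat) (eta : option nat).
Local Notation X := (vertex k eta).
Variable mu : {measure set X -> \bar R}.

Definition L2_pred : {pred X -> R[i]^o} :=
  fun f => `[< (\int[mu]_x (normsq (f x))%:E < +oo)%E >].

Let mX (d : measure_display) (Y : measurableType d) (f : X -> Y) :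
  measurable_fun setT f.
Proof. by []. Qed.

Let normsq_ge0 (z : R[i]) : 0 <= normsq z.
Proof. by rewrite addr_ge0 ?sqr_ge0. Qed.

Lemma L2_submod_closed : submod_closed L2_pred.
Proof.
split=> [|a f g /asboolP f2 /asboolP g2]; apply/asboolP.
  under eq_integral do rewrite /normsq /= expr0n addr0.
  by rewrite integral0.
pose c := 2 * normsq a.
have c0 : 0 <= c by rewrite mulr_ge0.
apply: (@le_lt_trans _ _ (\int[mu]_x
    (c%:E * (normsq (f x))%:E + 2%:E * (normsq (g x))%:E))%E).
  apply: ge0_le_integral => //; first by move=> x _; rewrite lee_fin.
  move=> x _; rewrite -!EFinM -EFinD lee_fin /c.
  have -> : (a *: f + g) x = a * f x + g x by [].
  rewrite /normsq; case: a {c c0} => a b.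
  case: (f x) => u v; case: (g x) => p q /=.
  rewrite -subr_ge0 (_ : _ - _ =
    (a * u - b * v - p) ^+ 2 + (a * v + b * u - q) ^+ 2); last by ring.
  by rewrite addr_ge0 ?sqr_ge0.
rewrite ge0_integralD //=.
rewrite !ge0_integralZl_EFin //.
by rewrite lte_add_pinfty // lte_mul_pinfty.
all: by move=> x _; rewrite ?mule_ge0 ?lee_fin.
Qed.

HB.instance Definition _ :=
  GRing.isSubmodClosed.Build R[i] (X -> R[i]^o) L2_pred L2_submod_closed.

(* Singletons having positive measure in the sequel, equality almost everywhere
   is equality, so no quotient is taken; every function is measurable. *)
Record L2 := MkL2 { L2_fun :> X -> R[i]^o ; _ : L2_fun \in L2_pred }.

HB.instance Definition _ := [isSub for L2_fun].
HB.instance Definition _ := [Choice of L2 by <:].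
HB.instance Definition _ := [SubChoice_isSubLmodule of L2 by <:].

Definition cintegral (h : X -> R[i]) : R[i] :=
  ((\int[mu]_x complex.Re (h x)) +i* (\int[mu]_x complex.Im (h x)))%C.

Let L2_int (f : L2) : (\int[mu]_x (normsq (f x))%:E < +oo)%E.
Proof. by case: f => f /= /asboolP. Qed.

Let int_dom (f g : L2) (h : X -> R) :
  (forall x, `|h x| <= normsq (f x) + normsq (g x)) ->
  mu.-integrable setT (EFin \o h).
Proof.
move=> hfg; apply: (@le_integrable _ _ _ _ _ _ _
    (fun x => (normsq (f x) + normsq (g x))%:E)) => //.
  move=> x _ /=; rewrite lee_fin; apply: le_trans (hfg x) _.
  exact: ler_norm.
apply/integrableP; split=> //.
under eq_integral do
  rewrite /= (ger0_norm (addr_ge0 (normsq_ge0 _) (normsq_ge0 _))) EFinD.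
rewrite ge0_integralD //; last 2 first.
- by move=> x _; rewrite lee_fin.
- by move=> x _; rewrite lee_fin.
by rewrite lte_add_pinfty ?L2_int.
Qed.

Lemma L2_Re_integrable (f g : L2) :
  mu.-integrable setT (EFin \o (fun x => complex.Re (f x * (g x)^*))).
Proof.
apply: (@int_dom f g) => x; rewrite /normsq.
case: (f x) => u v; case: (g x) => p q /=; rewrite ler_norml.
rewrite -subr_ge0 (_ : _ - - _ = ((u + p) ^+ 2 + (v + q) ^+ 2
  + u ^+ 2 + v ^+ 2 + p ^+ 2 + q ^+ 2) / 2); last by field.
rewrite divr_ge0 ?addr_ge0 ?sqr_ge0 //=.
rewrite -subr_ge0 (_ : _ - _ = ((u - p) ^+ 2 + (v - q) ^+ 2
  + u ^+ 2 + v ^+ 2 + p ^+ 2 + q ^+ 2) / 2); last by field.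
by rewrite divr_ge0 ?addr_ge0 ?sqr_ge0.
Qed.

Lemma L2_Im_integrable (f g : L2) :
  mu.-integrable setT (EFin \o (fun x => complex.Im (f x * (g x)^*))).
Proof.
apply: (@int_dom f g) => x; rewrite /normsq.
case: (f x) => u v; case: (g x) => p q /=; rewrite ler_norml.
rewrite -subr_ge0 (_ : _ - - _ = ((u - q) ^+ 2 + (v + p) ^+ 2
  + u ^+ 2 + v ^+ 2 + p ^+ 2 + q ^+ 2) / 2); last by field.
rewrite divr_ge0 ?addr_ge0 ?sqr_ge0 //=.
rewrite -subr_ge0 (_ : _ - _ = ((u + q) ^+ 2 + (v - p) ^+ 2
  + u ^+ 2 + v ^+ 2 + p ^+ 2 + q ^+ 2) / 2); last by field.
by rewrite divr_ge0 ?addr_ge0 ?sqr_ge0.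
Qed.

Context (mu_fin : forall x, (0 < mu [set x] < +oo)%E).

(* The unnamed argument only serves the positive definiteness below. *)
Definition L2_inner of (forall x, (0 < mu [set x] < +oo)%E) :=
  fun f g : L2 => cintegral (fun x => f x * (g x)^*).

Lemma L2_innerC f g : L2_inner mu_fin f g = (L2_inner mu_fin g f)^*.
Proof.
rewrite /L2_inner /cintegral /= -[RHS]/(conjc _) /=; congr (_ +i* _)%C.
  apply: eq_Rintegral => x _.
  by case: (f x) => u v; case: (g x) => p q /=; ring.
rewrite -mulN1r -RintegralZl //; last exact: L2_Im_integrable.
apply: eq_Rintegral => x _.
by case: (f x) => u v; case: (g x) => p q /=; ring.
Qed.

Lemma L2_innerDl h : zmod_morphism ((L2_inner mu_fin)^~ h).
Proof.
move=> f g; rewrite /L2_inner /cintegral /=.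
rewrite -[RHS]/((_ - _) +i* (_ - _))%C -!RintegralB //;
  try exact: L2_Re_integrable; try exact: L2_Im_integrable.
congr (_ +i* _)%C; apply: eq_Rintegral => x _.
  by rewrite [X in complex.Re X](_ : _ = f x * (h x)^* - g x * (h x)^*) ?mulrBl //;
   case: (f x * _) => ? ?; case: (g x * _).
by rewrite [X in complex.Im X](_ : _ = f x * (h x)^* - g x * (h x)^*) ?mulrBl //;
   case: (f x * _) => ? ?; case: (g x * _).
Qed.

Lemma L2_innerZl h : scalable_for *%R ((L2_inner mu_fin)^~ h).
Proof.
move=> a f; rewrite /L2_inner /cintegral /=.
have iR := L2_Re_integrable f h; have iI := L2_Im_integrable f h.
have iZ (b : R) (u : X -> R) : mu.-integrable setT (EFin \o u) ->
    mu.-integrable setT (EFin \o (fun x => b * u x)).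
  move=> iu; have := integrableZl measurableT b iu.
  by apply: eq_integrable.
have E x : (a *: f) x * (h x)^* = a * (f x * (h x)^*) by rewrite mulrA.
case: a E => a b E; rewrite -[RHS]/((_ - _) +i* (_ + _))%C -!RintegralZl //.
rewrite -RintegralB // -?RintegralD //; try exact: iZ.
by congr (_ +i* _)%C; apply: eq_Rintegral => x _; rewrite E;
  case: (f x * _).
Qed.

Lemma L2_inner_gt0 f : f != 0 -> 0 < L2_inner mu_fin f f.
Proof.
move=> f0; have [x fx0] : exists x, f x != 0.
  apply: contra_neqP f0 => /forallNP f0; apply/val_inj/funext => x /=.
  by apply/eqP/negP => /negP; exact: f0.
have -> : L2_inner mu_fin f f = ((\int[mu]_x normsq (f x)) +i* 0)%C.
  rewrite /L2_inner /cintegral; congr (_ +i* _)%C.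
    by apply: eq_Rintegral => y _; rewrite /normsq; case: (f y) => u v /=; ring.
  transitivity (\int[mu]_x (0 : R)); last by rewrite /Rintegral integral0.
  by apply: eq_Rintegral => y _; case: (f y) => u v /=; ring.
rewrite ltcE /= eqxx /=.
have nx : 0 < normsq (f x).
  rewrite lt_neqAle normsq_ge0 andbT eq_sym; apply: contraNneq fx0.
  rewrite /normsq; case: (f x) => u v /= /eqP.
  by rewrite paddr_eq0 ?sqr_ge0 // !sqrf_eq0 => /andP[/eqP-> /eqP->].
rewrite /Rintegral -lte_fin fineK; last first.
  rewrite ge0_fin_numE ?L2_int //.
  by apply: integral_ge0 => y _; rewrite lee_fin.
have /andP[mx0 _] := mu_fin x.
apply: (@lt_le_trans _ _ (\int[mu]_(y in [set x]) (normsq (f x))%:E)%E).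
  by rewrite integral_cst // mule_gt0 // lte_fin.
rewrite [leLHS](_ : _ = (\int[mu]_(y in [set x]) (normsq (f y))%:E)%E); last first.
  by apply: eq_integral => y /set_mem ->.
by apply: ge0_subset_integral => // y _; rewrite lee_fin.
Qed.

Lemma L2_innerDr f : zmod_morphism (L2_inner mu_fin f).
Proof.
move=> g h; rewrite (L2_innerC f g) (L2_innerC f h) -rmorphB -L2_innerDl.
exact: L2_innerC.
Qed.

Lemma L2_innerZr f : scalable_for (Num.conj \; *%R) (L2_inner mu_fin f).
Proof.
move=> a g; rewrite /= (L2_innerC f g) -rmorphM -L2_innerZl.
exact: L2_innerC.
Qed.

HB.instance Definition _ := @isBilinear.Build R[i] L2 L2 R[i]
  *%R (Num.conj \; *%R) (L2_inner mu_fin) L2_innerDl L2_innerDr L2_innerZl L2_innerZr.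
HB.instance Definition _ := @isHermitianSesquilinear.Build R[i] L2
  false Num.conj (L2_inner mu_fin)
  (fun f g => etrans (L2_innerC f g) (esym (mul1r _))).
HB.instance Definition _ := @isDotProduct.Build R[i] L2 (L2_inner mu_fin)
  L2_inner_gt0.

Definition L2_dot : inner_product L2 := L2_inner mu_fin.

(* The domain of C_phi is the whole of L^2. *)
Definition Cphi_dom := forall f : L2, (L2_fun f \o @phi k eta) \in L2_pred.

Definition Cphi (D : Cphi_dom) (f : L2) : L2 := MkL2 (D f).
End L2.

(* Main.v *)
From HB Require Import structures.
Require Import Defs.
From mathcomp Require Import all_boot all_order all_algebra.
From mathcomp Require Import sesquilinear complex ring lra.
From mathcomp Require Import all_classical all_reals all_analysis.

(** Write T for C_phi and, for a set A of finite measure, m_A(n) for the measure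
    of phi^{-n}(A), which is the squared norm of T^n applied to the indicator of
    A.  The operator T^{*n} T^n is multiplication by
    h_n(x) = m_{x}(n) / m_{x}(0) ([iter_adjoint]), so each defect operator is a
    multiplication operator ([defectE]), and its quadratic form at f is the
    alternating binomial sum of the squared norms of T^k f ([dot_defect]).

    A 2-isometry is completely hyperexpansive for a reason that has nothing to
    do with the graph: the squared norms of T^n f form a nonnegative affine
    sequence, and the alternating sums of such a sequence are nonpositive
    ([two_isometric_hyperexpansive]).

    Conversely, complete hyperexpansivity at order 1 and 2, tested on
    T^n applied to indicators, says that m_A is nondecreasing and concave for
    every A of finite measure.  Let a = m_{x_1} and let s(n) be the mass of
    the (n+1)-st level of the branches, that is m_G(n) for G the set of all
    x_{i,1}.  One turn around the circuit gives a(n + kappa) = a(n) + s(n) ([mass_turn]).  Concavity of a makes s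
    nonincreasing, while s is nondecreasing; so s is constant, the increments
    of a are both periodic and monotone, and a is affine
    ([mass_root_affine]).  The other vertices of the circuit have the same
    sequence shifted.  On the branches, s is constant while the contributions of
    one branch and of all the others are nondecreasing, so both are constant
    ([mass_branch_const]).  Hence h_0 - 2 h_1 + h_2 = 0 everywhere, which is
    2-isometry. *)

Set Implicit Arguments.
Unset Strict Implicit.
Unset Printing Implicit Defensive.
Import Order.TTheory GRing.Theory Num.Theory.
Import numFieldNormedType.Exports.
Local Open Scope classical_set_scope.
Local Open Scope ring_scope.

(** * Concave sequences and alternating binomial sums *)

Section sequences.
Context (R : realFieldType).
Implicit Types a : nat -> R.

Definition concave_seq a := forall n, a n.+2 + a n <= 2 * a n.+1.

Lemma concave_shift_nonincr a p : concave_seq a ->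
  forall n, a (n.+1 + p)%N - a n.+1 <= a (n + p)%N - a n.
Proof.
move=> ca n; elim: p => [|p IH]; first by rewrite !addn0 !subrr.
have := ca (n + p)%N; rewrite !addnS !addSn in IH *; lra.
Qed.

(** Concavity makes the p-step increments nonincreasing, so under the hypothesis
    they are constant.  The one-step increments are then p-periodic; being
    nonincreasing as well, they are constant. *)
Lemma concave_periodic_affine a p : (0 < p)%N -> concave_seq a ->
  (forall n, a (n + p)%N - a n <= a (n.+1 + p)%N - a n.+1) ->
  forall n, a n.+2 + a n = 2 * a n.+1.
Proof.
move=> p0 ca sa.
pose d n := a n.+1 - a n.
have dS n : d n.+1 <= d n by have := ca n; rewrite /d; lra.
have dp n : d (n + p)%N = d n.
  have := concave_shift_nonincr p ca n; have := sa n.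
  by rewrite /d addSn; lra.
have dmono n m : d (n + m)%N <= d n.
  elim: m => [|m IH]; first by rewrite addn0.
  by rewrite addnS (le_trans (dS _)).
move=> n; have := dS n; have := dmono n.+1 p.-1.
by rewrite addSn -addnS prednK // dp /d; lra.
Qed.

(** The m-th finite difference of a constant vanishes for m > 0, and that of
    the identity sequence is -1 for m = 1 and 0 for m > 1. *)
Lemma alt_binomial_affine (m : nat) (b c : R) : (0 < m)%N -> 0 <= c ->
  \sum_(i < m.+1) (-1) ^+ i * 'C(m, i)%:R * (b + i%:R * c) <= 0.
Proof.
have S0 n : \sum_(i < n.+1) (-1) ^+ i * 'C(n, i)%:R = (n == 0)%:R :> R.
  have := exprBn (1 : R) 1 n; rewrite subrr expr0n => ->.
  by apply: eq_bigr => i _; rewrite !expr1n !mulr1 mulr_natr.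
case: m => // m _ c0.
rewrite (eq_bigr (fun i : 'I_m.+2 => (-1) ^+ i * 'C(m.+1, i)%:R * b
    + (-1) ^+ i * (i * 'C(m.+1, i))%:R * c)); last first.
  by move=> i _; rewrite natrM; ring.
rewrite big_split /= -!mulr_suml S0 mul0r add0r.
rewrite big_ord_recl mul0n mulr0 add0r.
rewrite (eq_bigr (fun i : 'I_m.+1 => - m.+1%:R * ((-1) ^+ i * 'C(m, i)%:R)));
  last first.
  by move=> i _; rewrite lift0 -mul_bin_diag exprS natrM; ring.
by rewrite -mulr_sumr S0 !mulNr oppr_le0 !mulr_ge0 ?ler0n.
Qed.

Lemma affine_seq a : (forall n, a n.+2 + a n = 2 * a n.+1) ->
  forall n, a n = a 0%N + n%:R * (a 1%N - a 0%N).
Proof.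
move=> ha n.
suff: a n = a 0%N + n%:R * (a 1%N - a 0%N) /\
      a n.+1 = a 0%N + n.+1%:R * (a 1%N - a 0%N) by case.
elim: n => [|n [IH1 IH2]]; first by split; ring.
split=> //; have := ha n; rewrite IH1 IH2 => h.
by rewrite -[LHS](addrK (a 0 + n%:R * (a 1%N - a 0))) h; ring.
Qed.

End sequences.

(** An affine sequence with negative slope eventually becomes negative. *)
Lemma affine_ge0_incr (R : archiRealFieldType) (a : nat -> R) :
  (forall n, a n.+2 + a n = 2 * a n.+1) -> (forall n, 0 <= a n) ->
  0 <= a 1%N - a 0%N.
Proof.
move=> /affine_seq ha a0; rewrite leNgt; apply/negP; set c := _ - _ => c0.
have q0 : 0 <= a 0%N / - c by rewrite divr_ge0 // oppr_ge0 ltW.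
have := archi_boundP q0; rewrite ltr_pdivrMr ?oppr_gt0 // => h.
have := a0 (Num.bound (a 0%N / - c)); rewrite ha leNgt => /negP; apply.
rewrite -/c; lra.
Qed.

Lemma alt_binomial1 (R : comPzRingType) (c : nat -> R) :
  \sum_(i < 2) (-1) ^+ i * 'C(1, i)%:R * c i = c 0%N - c 1%N.
Proof. by rewrite !big_ord_recl big_ord0 /= /bump /= bin0 binn; ring. Qed.

Lemma alt_binomial2 (R : comPzRingType) (c : nat -> R) :
  \sum_(i < 3) (-1) ^+ i * 'C(2, i)%:R * c i = c 0%N - 2 * c 1%N + c 2%N.
Proof.
by rewrite !big_ord_recl big_ord0 /= /bump /= bin0 bin1 binn; ring.
Qed.

(** * Integration against the atoms *)

Section atomic.
Context (R : realType) (k : nat) (eta : option nat).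
Local Notation X := (vertex k eta).

(* The vertices are enumerated by [pickle]; a natural number that codes no
   vertex gives the empty set. *)
Let atom n : set X := [set x | pickle x = n].

Let atomP n : atom n = set0 \/ exists x, atom n = [set x].
Proof.
case: (pselect (exists x, atom n x)) => [[x xn]|n0]; [right|left].
  exists x; apply/seteqP; split=> [y yn|y -> //].
  by apply: (pcan_inj pickleK); rewrite xn.
by apply/seteqP; split=> // x xn; case: n0; exists x.
Qed.

Lemma integral_point (nu : {measure set X -> \bar R}) (g : X -> \bar R) x :
  (\int[nu]_(y in [set x]) g y = g x * nu [set x])%E.
Proof.
rewrite -integral_cst //.
by apply: eq_integral => y /set_mem ->.
Qed.

(** X is a countable union of atoms and all its subsets are measurable, so an
    integral is the sum of its values on singletons.  Allowing two measures
    makes this a change-of-density formula. *)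
Lemma ge0_integral_atoms (nu nu' : {measure set X -> \bar R})
    (g g' : X -> \bar R) :
  (forall x, 0 <= g x)%E -> (forall x, 0 <= g' x)%E ->
  (forall x, g x * nu [set x] = g' x * nu' [set x])%E ->
  (\int[nu]_x g x = \int[nu']_x g' x)%E.
Proof.
move=> g0 g'0 gg'.
have cov : setT = \bigcup_n atom n by apply/seteqP; split=> // x _; exists (pickle x).
have tri : trivIset setT atom by move=> i j _ _ [x [<- <-]].
rewrite cov !ge0_integral_bigcup //.
apply: eq_eseriesr => n _.
by case: (atomP n) => [->|[x ->]]; rewrite ?integral_set0 // !integral_point.
Qed.

Let maxe0_pMr (y z : \bar R) : (0 <= z)%E ->
  (maxe y 0 * z = maxe (y * z) 0)%E.
Proof.
move=> z0; have [y0|y0] := leP 0%E y; first by rewrite max_l // mule_ge0.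
by rewrite mul0e max_r // mule_le0_ge0 // ltW.
Qed.

(** The positive and negative parts are compared separately, so the identity
    also covers functions that are not integrable: [fine] then sends both sides
    to the same value. *)
Lemma Rintegral_atoms (nu nu' : {measure set X -> \bar R}) (g g' : X -> R) :
  (forall x, (g x)%:E * nu [set x] = (g' x)%:E * nu' [set x])%E ->
  \int[nu]_x g x = \int[nu']_x g' x.
Proof.
move=> gg'; rewrite /Rintegral; congr fine.
rewrite integralE [in RHS]integralE; congr (_ - _)%E;
  apply: ge0_integral_atoms => // x.
  by rewrite !funeposE !maxe0_pMr // gg'.
by rewrite !funenegE !maxe0_pMr // !mulNe gg'.
Qed.
End atomic.

(** [pushforward] is a measure only in the presence of a proof of measurability.
    Here every map is measurable, and a separate constant lets the measure
    structure be inferred without that proof. *)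
Definition image_measure (R : realType) k eta
    (nu : {measure set (vertex k eta) -> \bar R})
    (f : vertex k eta -> vertex k eta) : set (vertex k eta) -> \bar R :=
  pushforward nu f.

Section image_measure.
Context (R : realType) (k : nat) (eta : option nat).
Local Notation X := (vertex k eta).
Context (nu : {measure set X -> \bar R}) (f : X -> X).

Let image0 : image_measure nu f set0 = 0%E.
Proof. exact: measure0. Qed.

Let image_ge0 A : (0 <= image_measure nu f A)%E.
Proof. exact: measure_ge0. Qed.

Let image_sigma_additive : semi_sigma_additive (image_measure nu f).
Proof. exact: measure_semi_sigma_additive. Qed.

HB.instance Definition _ := isMeasure.Build _ _ _ (image_measure nu f)
  image0 image_ge0 image_sigma_additive.

Lemma Rintegral_image (u : X -> R) :
  \int[image_measure nu f]_x u x = \int[nu]_x u (f x).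
Proof.
rewrite /Rintegral; congr fine.
rewrite integralE [in RHS]integralE; congr (_ - _)%E;
  rewrite ge0_integral_pushforward ?preimage_setT //;
  by apply: eq_integral => x _; rewrite /= ?funeposE ?funenegE.
Qed.
End image_measure.

(** * The composition operator on L^2 *)

Section composition.
Context (R : realType) (k : nat) (eta : option nat).
Local Notation X := (vertex k eta).
Context (mu : {measure set X -> \bar R}).
Context (mu_fin : forall x, (0 < mu [set x] < +oo)%E).
Context (D : Cphi_dom mu) (Cb : bounded_operator (L2_dot mu_fin) (Cphi D)).
Local Notation T := (Cphi D).
Local Notation dot := (L2_dot mu_fin).

Lemma iter_CphiE n f x : iter n T f x = f (iter n (@phi k eta) x).
Proof. by elim: n x => //= n IH x; rewrite IH -iterSr. Qed.

(** For A of finite measure this is the squared norm of C_phi^n applied to the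
    indicator of A ([norm2_iter_indic]), which is how the operator
    inequalities become inequalities between masses. *)
Definition mass (A : set X) n : R := fine (mu (iter n (@phi k eta) @^-1` A)).

Lemma mass_ge0 A n : 0 <= mass A n.
Proof. exact: fine_ge0. Qed.

Lemma normsq_indic (A : set X) x : normsq ((\1_A x : R)%:C%C) = \1_A x.
Proof. by rewrite /normsq /= indicE; case: (x \in A); rewrite /= ?expr1n ?expr0n addr0. Qed.

Lemma indic_in_L2 (A : set X) : (mu A < +oo)%E ->
  (fun x => (\1_A x : R)%:C%C) \in L2_pred mu.
Proof.
move=> A_fin; apply/asboolP.
under eq_integral do rewrite normsq_indic.
by rewrite integral_indic // setIT.
Qed.

Definition L2_indic A (A_fin : (mu A < +oo)%E) : L2 mu := MkL2 (indic_in_L2 A_fin).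

Lemma normsq_iter_indic A (A_fin : (mu A < +oo)%E) n x :
  normsq (iter n T (L2_indic A_fin) x) = \1_(iter n (@phi k eta) @^-1` A) x.
Proof. by rewrite iter_CphiE normsq_indic. Qed.

(** The indicator of A is in L^2; as C_phi is everywhere defined, so is its
    image under C_phi^n. *)
Lemma preim_lty A n : (mu A < +oo)%E ->
  (mu (iter n (@phi k eta) @^-1` A) < +oo)%E.
Proof.
move=> A_fin; have := valP (iter n T (L2_indic A_fin)) => /asboolP.
under eq_integral do rewrite normsq_iter_indic.
by rewrite integral_indic // setIT.
Qed.

Definition norm2 (f : L2 mu) : R := \int[mu]_x normsq (f x).

Lemma dot_self f : dot f f = (norm2 f)%:C%C.
Proof.
rewrite /= /L2_inner /cintegral /norm2; congr (_ +i* _)%C.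
  by apply: eq_Rintegral => y _; rewrite /normsq; case: (f y) => u v /=; ring.
transitivity (\int[mu]_x (0 : R)); last by rewrite /Rintegral integral0.
by apply: eq_Rintegral => y _; case: (f y) => u v /=; ring.
Qed.

Lemma norm2_ge0 f : 0 <= norm2 f.
Proof. by rewrite -ler0c -dot_self dnorm_ge0. Qed.

Lemma norm2_iter_indic A (A_fin : (mu A < +oo)%E) n :
  norm2 (iter n T (L2_indic A_fin)) = mass A n.
Proof.
rewrite /norm2; under eq_Rintegral do rewrite normsq_iter_indic.
by rewrite /Rintegral integral_indic // setIT.
Qed.

Lemma pt_lty x : (mu [set x] < +oo)%E.
Proof. by case/andP: (mu_fin x). Qed.

Lemma mass_pt_gt0 x : 0 < mass [set x] 0.
Proof. by rewrite fine_gt0 //; exact: mu_fin. Qed.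

Lemma massE A n : (mu A < +oo)%E -> (mass A n)%:E = mu (iter n (@phi k eta) @^-1` A).
Proof. by move=> A_fin; rewrite fineK // ge0_fin_numE ?preim_lty. Qed.

(** The Radon-Nikodym derivative of the image of mu under phi^n with respect
    to mu; multiplication by it is T^{*n} T^n. *)
Definition density n x : R := mass [set x] n / mass [set x] 0.

Lemma density_ge0 n x : 0 <= density n x.
Proof. by rewrite divr_ge0 // mass_ge0. Qed.

Lemma Rintegral_density n (u : X -> R) :
  \int[mu]_x (u x * density n x) = \int[mu]_x u (iter n (@phi k eta) x).
Proof.
rewrite -Rintegral_image; apply: Rintegral_atoms => x.
have E0 : mu [set x] = (mass [set x] 0)%:E by rewrite massE ?pt_lty.
have En : image_measure mu (iter n (@phi k eta)) [set x] = (mass [set x] n)%:E.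
  by rewrite massE ?pt_lty.
rewrite E0 [X in _ = (_ * X)%E]En -!EFinM.
by rewrite -mulrA divfK // gt_eqF // mass_pt_gt0.
Qed.

(** A real form of the boundedness hypothesis.  The bound supplied there is a
    complex number of unknown sign, hence the passage to its modulus. *)
Lemma Cphi_norm2_le : exists2 M : R, 0 <= M & forall f, norm2 (T f) <= M * norm2 f.
Proof.
case: Cb => _ [M bM]; exists (normsq M); first by rewrite addr_ge0 ?sqr_ge0.
move=> f; have := bM f; rewrite !dot_self.
set a : R[i] := (norm2 (T f))%:C%C; set b : R[i] := (norm2 f)%:C%C => le_ab.
have a0 : 0 <= a by rewrite ler0c norm2_ge0.
have b0 : 0 <= b by rewrite ler0c norm2_ge0.
have sa0 : 0 <= sqrtC a by rewrite sqrtC_ge0.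
have : `|sqrtC a| ^+ 2 <= `|M * sqrtC b| ^+ 2.
  rewrite ler_pXn2r ?nnegrE ?normr_ge0 //.
  by rewrite !ger0_norm // (le_trans sa0).
rewrite normrM exprMn -!normrX !sqrtCK normrX -add_Re2_Im2.
by rewrite !ger0_norm // /a /b -/(normsq M) -rmorphM lecR.
Qed.

(** Test the bound on the norm of C_phi^n on the indicators of singletons. *)
Lemma density_bounded n : exists M : R, forall x, density n x <= M.
Proof.
have [M M0 bM] := Cphi_norm2_le; exists (M ^+ n) => x.
rewrite ler_pdivrMr ?mass_pt_gt0 //.
rewrite -!(norm2_iter_indic (pt_lty x)).
elim: n => [|n IH]; first by rewrite mul1r.
by rewrite iterS (le_trans (bM _)) // exprS -mulrA ler_wpM2l.
Qed.

Lemma mul_density_in_L2 n (f : L2 mu) :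
  (fun x => (density n x)%:C%C * f x) \in L2_pred mu.
Proof.
have [M hM] := density_bounded n.
have /asboolP f2 := valP f.
apply/asboolP; apply: le_lt_trans
  (_ : \int[mu]_x ((M ^+ 2)%:E * (normsq (f x))%:E) < _)%E.
  have nn z : 0 <= normsq (z : R[i]) by rewrite addr_ge0 ?sqr_ge0.
  apply: ge0_le_integral => //= x _; first by rewrite lee_fin.
  rewrite -EFinM lee_fin.
  have -> : normsq ((density n x)%:C%C * f x) = density n x ^+ 2 * normsq (f x).
    by rewrite /normsq; case: (f x) => u v /=; ring.
  by rewrite ler_wpM2r // ler_pXn2r ?nnegrE ?(le_trans _ (hM x)) ?density_ge0.
rewrite ge0_integralZl_EFin ?sqr_ge0 //; last by move=> x _; rewrite lee_fin addr_ge0 ?sqr_ge0.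
by rewrite lte_mul_pinfty // lee_fin sqr_ge0.
Qed.

Definition mul_density n f : L2 mu := MkL2 (mul_density_in_L2 n f).

(** Both sides integrate f times the conjugate of g against the image of mu
    under phi^(n+1). This evaluates the adjoint of C_phi on functions of the form
    h_n (g o phi), which are the only ones met in T^{*n} T^n; so the adjoint of
    C_phi on all of L^2 does not have to be constructed. *)
Lemma dot_Cphi_mul_density n f g :
  dot (T f) (mul_density n (T g)) = dot f (mul_density n.+1 g).
Proof.
have shift (u : X -> R) : \int[mu]_x (u (phi x) * density n x) =
    \int[mu]_x (u x * density n.+1 x).
  rewrite (Rintegral_density n (u \o @phi k eta)) Rintegral_density.
  by apply: eq_Rintegral => x _ /=; rewrite -iterS.
rewrite /= /L2_inner /cintegral /=; congr (_ +i* _)%C.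
  transitivity (\int[mu]_x (complex.Re (f (phi x) * (g (phi x))^*) * density n x)).
    by apply: eq_Rintegral => x _; case: (f _) (g _) => a b [c d] /=; ring.
  rewrite (shift (fun x => complex.Re (f x * (g x)^*))).
  by apply: eq_Rintegral => x _; case: (f _) (g _) => a b [c d] /=; ring.
transitivity (\int[mu]_x (complex.Im (f (phi x) * (g (phi x))^*) * density n x)).
  by apply: eq_Rintegral => x _; case: (f _) (g _) => a b [c d] /=; ring.
rewrite (shift (fun x => complex.Im (f x * (g x)^*))).
by apply: eq_Rintegral => x _; case: (f _) (g _) => a b [c d] /=; ring.
Qed.

(** The induction peels T^{*(n+1)} T^(n+1) g as T^* applied to
    T^{*n} T^n (T g) = h_n (g o phi). *)
Lemma iter_adjoint n g : iter n (adjoint dot T) (iter n T g) = mul_density n g.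
Proof.
elim: n g => [|n IH] g.
  apply/val_inj/funext => x /=.
  by rewrite /density divff ?mul1r // gt_eqF // mass_pt_gt0.
rewrite iterS [iter n.+1 T g]iterSr IH.
by apply: adjointE => f; exact: dot_Cphi_mul_density.
Qed.

Lemma dot_mul_density n f g :
  dot f (mul_density n g) = dot (iter n T f) (iter n T g).
Proof.
elim: n f g => [|n IH] f g.
  by rewrite -iter_adjoint.
by rewrite -dot_Cphi_mul_density IH -!iterSr.
Qed.

Definition defect_symbol m x : R :=
  \sum_(i < m.+1) (-1) ^+ i * 'C(m, i)%:R * density i x.

Lemma defectE m f x :
  defect dot m T f x = (defect_symbol m x)%:C%C * f x.
Proof.
rewrite /defect.
have L2_sum (F : 'I_m.+1 -> L2 mu) : (\sum_i F i : L2 mu) x = \sum_i F i x.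
  by elim/big_rec2: _ => // i y1 y2 _ <-.
rewrite L2_sum /defect_symbol rmorph_sum mulr_suml; apply: eq_bigr => i _.
by rewrite iter_adjoint 2!rmorphM rmorphXn rmorphN1 rmorph_nat -[RHS]mulrA.
Qed.

Lemma dot_defect m f : dot (defect dot m T f) f =
  (\sum_(i < m.+1) (-1) ^+ i * 'C(m, i)%:R * norm2 (iter i T f))%:C%C.
Proof.
rewrite /defect linear_sumlz rmorph_sum /=; apply: eq_bigr => i _.
rewrite linearZl_LR /= iter_adjoint rmorphM rmorphM rmorphXn rmorphN1 rmorph_nat.
congr (_ * _); rewrite L2_innerC -/(dot f (mul_density i f)).
by rewrite dot_mul_density dot_self; exact: conjc_real.
Qed.

Lemma nonpositive_defectE m f : (dot (defect dot m T f) f <= 0) =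
  (\sum_(i < m.+1) (-1) ^+ i * 'C(m, i)%:R * norm2 (iter i T f) <= 0).
Proof. by rewrite dot_defect -(lecR _ 0). Qed.

(** Along an orbit of a 2-isometry, the squared norms form an affine sequence;
    as they are nonnegative its slope is nonnegative, and all the alternating
    sums have the right sign. *)
Lemma two_isometric_hyperexpansive :
  two_isometric dot T -> completely_hyperexpansive dot T.
Proof.
move=> T2 m m0 f; rewrite nonpositive_defectE.
pose c n := norm2 (iter n T f).
have c_affine n : c n.+2 + c n = 2 * c n.+1.
  have := dot_defect 2 (iter n T f).
  rewrite T2 linear0l => /(congr1 (@complex.Re R)) /=.
  rewrite (alt_binomial2 (fun i => norm2 (iter i T (iter n T f)))) /= /c /=.
  lra.
rewrite (eq_bigr (fun i : 'I_m.+1 =>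
    (-1) ^+ i * 'C(m, i)%:R * (c 0%N + i%:R * (c 1%N - c 0%N)))); last first.
  by move=> i _; rewrite -affine_seq.
apply: alt_binomial_affine => //; apply: affine_ge0_incr => // n.
exact: norm2_ge0.
Qed.

Section hyperexpansive.
Context (Th : completely_hyperexpansive dot T).

(** Nonpositivity of the first defect operator at C_phi^n of the indicator of A. *)
Lemma mass_nondecr A n : (mu A < +oo)%E -> mass A n <= mass A n.+1.
Proof.
move=> A_fin; have := Th (erefl : 0 < 1)%N (iter n T (L2_indic A_fin)).
rewrite nonpositive_defectE.
rewrite (alt_binomial1 (fun i => norm2 (iter i T (iter n T _)))).
rewrite /= -!iterS !norm2_iter_indic; lra.
Qed.

(** Nonpositivity of the second defect operator at C_phi^n of the indicator of A. *)
Lemma mass_concave A : (mu A < +oo)%E -> concave_seq (mass A).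
Proof.
move=> A_fin n; have := Th (erefl : 0 < 2)%N (iter n T (L2_indic A_fin)).
rewrite nonpositive_defectE.
rewrite (alt_binomial2 (fun i => norm2 (iter i T (iter n T _)))).
rewrite /= -!iterS !norm2_iter_indic; lra.
Qed.

End hyperexpansive.

Lemma two_isometric_mass : (forall x,
    mass [set x] 2 + mass [set x] 0 = 2 * mass [set x] 1) ->
  two_isometric dot T.
Proof.
move=> h f; apply/val_inj/funext => x /=; rewrite defectE.
suff -> : defect_symbol 2 x = 0 by rewrite mul0r.
rewrite /defect_symbol (alt_binomial2 (density^~ x)) /density.
rewrite mulrA -mulrBl -mulrDl -(h x); ring.
Qed.
End composition.

(** * Preimages in the graph *)

Section graph.
Context (k : nat) (eta : option nat).
Local Notation X := (vertex k eta).
Local Notation phi := (@phi k eta).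

(** The set of the x_{i,1}: together with x_1, the preimage of x_kappa. *)
Definition first_level : set X := [set x | exists i, x = inr (i, 0%N)].

Let val_ord_pred (i : 'I_k.+1) : ord_pred i = (if i == 0 then k else i.-1) :> nat.
Proof.
case: i => [[|i] ik] /=; first by rewrite modn_small.
by rewrite modnDr modn_small // ltnW.
Qed.

Lemma preimage_circuit (r : nat) : (r < k)%N ->
  phi @^-1` [set inl (inord r)] = [set inl (inord r.+1)].
Proof.
move=> rk; have rk1 : (r < k.+1)%N by exact: ltnW.
apply/seteqP; split=> -[i|[i [|j]]] //=.
- case=> /(congr1 (@nat_of_ord _)); rewrite val_ord_pred inordK //.
  case: eqP => [_ kr|]; first by rewrite -kr ltnn in rk.
  move=> i0 ir; congr inl; apply/val_inj; rewrite /= inordK // -ir prednK //.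
  by rewrite lt0n; apply/eqP => i00; apply: i0; apply/val_inj.
- by case=> /(congr1 val) /=; rewrite inordK // => rk'; rewrite -rk' ltnn in rk.
- case=> ->; congr inl; apply/ord_inj; rewrite val_ord_pred /= !inordK //.
  by rewrite -val_eqE /= inordK.
Qed.

Lemma preimage_circuit_max :
  phi @^-1` [set inl ord_max] = [set inl ord0] `|` first_level.
Proof.
apply/seteqP; split=> -[i|[i [|j]]] //=.
- case=> /(etrans (esym (val_ord_pred i))); case: eqP => [-> _|/eqP i0 ik]; first by left.
  by have := ltn_ord i; rewrite ltnS -[leqRHS]ik leqNgt ltn_predL lt0n i0.
- by move=> _; right; exists i.
- case=> [[->]|[? //]]; congr inl; apply/ord_inj.
  by rewrite val_ord_pred eqxx.
- by case=> // -[i' [_ ?]].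
Qed.

Lemma preimage_branch i j : phi @^-1` [set inr (i, j)] = [set inr (i, j.+1)].
Proof. by apply/seteqP; split=> -[r|[i' [|j']]] //= [-> ->]. Qed.

Lemma preimage_iterS n A : iter n.+1 phi @^-1` A = phi @^-1` (iter n phi @^-1` A).
Proof. by apply/seteqP; split=> x /=; rewrite -iterS iterSr. Qed.

Lemma preimage_iter_circuit (r : nat) : (r < k.+1)%N ->
  iter r phi @^-1` [set inl ord0] = [set inl (inord r)].
Proof.
elim: r => [|r IH] rk.
  by rewrite (_ : inord 0 = ord0) //; apply/val_inj; rewrite /= inordK.
by rewrite preimage_iterS IH ?preimage_circuit // ltnW.
Qed.

(** Going once around the circuit adds the first points of the branches. *)
Lemma preimage_iter_turn :
  iter k.+1 phi @^-1` [set inl ord0] = [set inl ord0] `|` first_level.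
Proof.
rewrite preimage_iterS preimage_iter_circuit // -preimage_circuit_max.
by congr (_ @^-1` [set inl _]); apply/val_inj; rewrite /= inordK.
Qed.

Lemma preimage_iter_branch i j :
  iter j phi @^-1` [set inr (i, 0%N)] = [set inr (i, j)].
Proof. by elim: j => // j IH; rewrite preimage_iterS IH preimage_branch. Qed.

End graph.

(** * Masses of preimages under complete hyperexpansivity *)

Section hyperexpansive_graph.
Context (R : realType) (k : nat) (eta : option nat).
Local Notation X := (vertex k eta).
Context (mu : {measure set X -> \bar R}).
Context (mu_fin : forall x, (0 < mu [set x] < +oo)%E).
Context (D : Cphi_dom mu) (Cb : bounded_operator (L2_dot mu_fin) (Cphi D)).
Context (Th : completely_hyperexpansive (L2_dot mu_fin) (Cphi D)).
Local Notation mass := (mass mu).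
Local Notation phi := (@phi k eta).

Lemma mass_preimage_iter A p n : mass (iter p phi @^-1` A) n = mass A (n + p)%N.
Proof.
rewrite /mass addnC; congr (fine (mu _)).
by apply/seteqP; split=> x /=; rewrite iterD.
Qed.

Lemma massU A B n : (mu A < +oo)%E -> (mu B < +oo)%E -> A `&` B = set0 ->
  mass (A `|` B) n = mass A n + mass B n.
Proof.
move=> A_fin B_fin AB0; rewrite /mass preimage_setU measureU //; last first.
  by rewrite -preimage_setI AB0 preimage_set0.
by rewrite fineD // ge0_fin_numE ?(preim_lty D).
Qed.

Let root : X := inl ord0.
Let p_fin x : (mu [set x] < +oo)%E := pt_lty mu_fin x.

(** There may be infinitely many branches; finiteness comes from
    [preimage_iter_turn]. *)
Lemma first_level_fin : (mu (@first_level k eta) < +oo)%E.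
Proof.
have := preim_lty D k.+1 (p_fin root); rewrite preimage_iter_turn.
by apply: le_lt_trans; apply: le_measure; rewrite ?inE //; right.
Qed.

Lemma mass_turn n :
  mass [set root] (n + k.+1)%N = mass [set root] n + mass (@first_level k eta) n.
Proof.
rewrite -mass_preimage_iter preimage_iter_turn massU ?first_level_fin ?p_fin //.
by apply/seteqP; split=> // _ [-> [i //]].
Qed.

(** By [mass_turn] the increment of the root masses over one turn is the mass of
    a level of the branches.  Levels have nondecreasing mass, while concavity
    of the root masses forces nonincreasing increments. *)
Lemma mass_root_affine n :
  mass [set root] n.+2 + mass [set root] n = 2 * mass [set root] n.+1.
Proof.
apply: (@concave_periodic_affine _ _ k.+1) => //.
  exact: (mass_concave Cb Th (p_fin root)).
move=> j; rewrite !mass_turn.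
have := mass_nondecr Cb Th j first_level_fin; lra.
Qed.

Lemma mass_first_level_noninc n :
  mass (@first_level k eta) n.+1 <= mass (@first_level k eta) n.
Proof.
have := concave_shift_nonincr k.+1 (mass_concave Cb Th (p_fin root)) n.
rewrite !mass_turn; lra.
Qed.

(** The branch and the union of the other branches both have nondecreasing
    mass level by level, and the total does not increase. *)
Lemma mass_branch_const i n :
  mass [set inr (i, 0%N)] n.+1 = mass [set inr (i, 0%N)] n.
Proof.
set y : X := inr (i, 0%N).
have split_level : @first_level k eta = [set y] `|` (first_level (eta:=eta) `\ y).
  by rewrite setDUK // => _ ->; exists i.
have rest_fin : (mu (first_level (eta:=eta) `\ y) < +oo)%E.
  by apply: le_lt_trans first_level_fin; apply: le_measure; rewrite ?inE // => x [].
have level_mass j : mass (@first_level k eta) j =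
    mass [set y] j + mass (first_level (eta:=eta) `\ y) j.
  by rewrite [in LHS]split_level massU ?p_fin // setDIK.
have := mass_first_level_noninc n; rewrite !level_mass.
have := mass_nondecr Cb Th n (p_fin y).
have := mass_nondecr Cb Th n rest_fin; lra.
Qed.

(** Iterated preimages of a circuit vertex are, after a shift, those of x_1;
    those of a branch vertex stay in its branch. *)
Lemma hyperexpansive_mass_affine x :
  mass [set x] 2 + mass [set x] 0 = 2 * mass [set x] 1.
Proof.
case: x => [r|[i j]].
  have <- : iter r phi @^-1` [set root] = [set inl r].
    by rewrite preimage_iter_circuit // inord_val.
  by rewrite !mass_preimage_iter mass_root_affine.
rewrite -preimage_iter_branch !mass_preimage_iter !addSn !mass_branch_const.
lra.
Qed.
End hyperexpansive_graph.

Theorem corollary2p14 (R : realType) (k : nat) (eta : option nat)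
    (eta_gt0 : eta <> Some 0%N)
    (mu : {measure set (vertex k eta) -> \bar R})
    (mu_fin : forall x, (0 < mu [set x] < +oo)%E)
    (D : Cphi_dom mu) (Cphi_bounded : bounded_operator (L2_dot mu_fin) (Cphi D)) :
  completely_hyperexpansive (L2_dot mu_fin) (Cphi D) <->
  two_isometric (L2_dot mu_fin) (Cphi D).
Proof.
split=> [Th|]; last exact: two_isometric_hyperexpansive.
apply: two_isometric_mass => // x.
exact: hyperexpansive_mass_affine Th x.
Qed.
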